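(* Consider Models 1, 2, 3 described in the context. Suppose that: (A1) in Model 1, the loss function is $\gamma$-strongly convex in $\theta$ and $\beta$-smooth; (A2) in Model 2, $\bar A_j^\top\bar A_j\succ0$ for all $j\in[J]$, with $\alpha=2\min_{j\in[J]}\lambda_{\min}(\bar A_j^\top\bar A_j)$, and the set $\Theta$ and the supports of the reference distributions are bounded; (A3) in Model 3, the loss function is $\gamma$-strongly convex in $\theta$ and $\beta$-smooth, and $\mathcal Z$ has finite diameter $D<\infty$. Suppose the distribution map $\hat{\mathbb P}(\cdot)$ is $\epsilon$-sensitive, that the loss function is $L_z$-Lipschitz in the random parameter, and, for Model 3, that it is also $L_\theta$-Lipschitz in $\theta$. Then the following bounds hold: (a) Model 1: $\displaystyle\mathbb J_{\theta_{\mathrm{RPS}}}(\theta_{\mathrm{RPS}})-\mathbb J_{\theta_{\mathrm{RPO}}}(\theta_{\mathrm{RPO}})\le\frac{2\epsilon^2L_z^2}{\gamma+2\rho L}.$ (b) Model 2: $\displaystyle\mathbb J^\mu_{\theta^\mu_{\mathrm{RPS}}}(\theta^\mu_{\mathrm{RPS}})-\mathbb J_{\theta_{\mathrm{RPO}}}(\theta_{\mathrm{RPO}})\le\frac{2(\epsilon L_z+2\mu'\log J)^2}{\rho\alpha}$, where $\mu'\in[0,1]$ is a constant satisfying $\mu\le\mu'\|\theta^\mu_{\mathrm{RPS}}-\theta_{\mathrm{RPO}}\|_2$. (c) Model 3: $\displaystyle\mathbb J^\tau_{\theta^\tau_{\mathrm{RPS}}}(\bar\theta^\tau_{\mathrm{RPS}})-\mathbb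 J_{\theta_{\mathrm{RPO}}}(\bar\theta_{\mathrm{RPO}})\le\tau\bar\lambda^2+\frac{(2\tau\bar\lambda+\rho^2+D^2+L_\theta+\epsilon L_z)\,2\epsilon L_z}{\min(\gamma,2\tau)}$, where $\displaystyle\bar\lambda=\frac{\sqrt{\rho^4+4\tau(\bar\ell-\underline\ell)}-\rho^2}{2\tau}$ and $\underline\ell,\bar\ell\in\mathbb R$ satisfy $\underline\ell\le\ell(z,\theta)\le\bar\ell$ for all $(z,\theta)\in\mathcal Z\times\Theta$.
   Context: General setting. $\Theta\subseteq\mathbb R^d$ is a nonempty closed convex decision set; the loss $\ell$ is convex in $\theta$ for fixed value of the random parameter. $[n]=\{1,\dots,n\}$ and $\mathbb S^n$ is the space of real symmetric $n\times n$ matrices. The reference distribution map is $\hat{\mathbb P}(\theta)=\sum_{s=1}^S\hat p_s(\theta)\delta_{\hat z_s(\theta)}$ ($\hat p_s(\theta)\ge0$, $\sum_s\hat p_s(\theta)=1$). $\rho>0$ is the radius of the ambiguity set $\mathbb B(\hat{\mathbb P}(\eta))=\{\mathbb Q:W_r(\mathbb Q,\hat{\mathbb P}(\eta))\le\rho\}$, and the robust decoupled performative risk is $\mathbb J_\eta(\theta)=\sup_{\mathbb Q\in\mathbb B(\hat{\mathbb P}(\eta))}\mathbb E_{\mathbb Q}[\ell(\tilde z,\theta)]$, used in the explicit form that the paper's reformulation gives it in each model (stated below and taken as part of the setting). A robust performatively optimal decision is $\theta_{\mathrm{RPO}}\in\arg\min_{\theta\in\Theta}\mathbb J_\theta(\theta)$.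 A robust performatively stable decision is $\theta_{\mathrm{RPS}}\in\arg\min_{\theta\in\Theta}\mathbb J_{\theta_{\mathrm{RPS}}}(\theta)$. Definitions. $\ell(z,\theta)$ is $\gamma$-strongly convex in $\theta$ if $\ell(z,\theta)\ge\ell(z,\theta')+\nabla_\theta\ell(z,\theta')^\top(\theta-\theta')+\frac\gamma2\|\theta-\theta'\|_2^2$ for all $\theta,\theta'\in\Theta$ and all $z$. It is $\beta$-smooth if $\|\nabla_\theta\ell(z,\theta)-\nabla_\theta\ell(z',\theta)\|_2\le\beta\|z-z'\|_2$ for all $z,z'$ and $\theta\in\Theta$. $\hat{\mathbb P}(\cdot)$ is $\epsilon$-sensitive if $W_1(\hat{\mathbb P}(\theta),\hat{\mathbb P}(\theta'))\le\epsilon\|\theta-\theta'\|_2$ for all $\theta,\theta'\in\Theta$, with $W_1$ the 1-Wasserstein distance for the Euclidean norm (Frobenius norm for matrix-valued parameters); Lipschitz continuity in the random parameter is with respect to the same norm. Model 1. Random parameter $Z=(Y,z,z^0)\in\mathbb S^d\times\mathbb R^d\times\mathbb R$, identified with $\begin{bmatrix}Y & z \\ z^\top & z^0\end{bmatrix}$; $\ell(Z,\theta)=\mathcal L(\theta^\top Y\theta+2z^\top\theta+z^0)$, $\mathcal L:\mathbb R\to\mathbb R$ $L$-Lipschitz; type-1 Wasserstein ball with Schatten-$\infty$ (spectral norm) ground cost; $\mathbb J_\eta(\theta)=\mathbb E_{\hat{\mathbb P}(\eta)}[\ell(\tilde Z,\theta)]+\rho L\|(\theta,1)\|_2^2$.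 Model 2. Random parameter $Z=(Y,z,z^0)\in\mathbb S^N\times\mathbb R^N\times\mathbb R$, identified with $\begin{bmatrix}Y & z \\ z^\top & z^0\end{bmatrix}$; $\ell(Z,\theta)=\max_{j\in[J]}Q_j(Z,\theta)$, $Q_j(Z,\theta)=a_j(\theta)^\top Ya_j(\theta)+2b_j(\theta)^\top z+c_j(\theta)z^0$, with affine $a_j(\theta)=\bar a_j+\bar A_j\theta$, $b_j(\theta)=\bar b_j+\bar B_j\theta$ in $\mathbb R^N$ and $c_j(\theta)=\bar c_{j0}+\bar c_j^\top\theta\in\mathbb R$; the $Y$-component of every scenario is positive semidefinite. Type-1 Wasserstein ball with Schatten-$\infty$ ground cost; $$\mathbb J_\eta(\theta)=\sum_{s\in[S]}\hat p_s(\eta)\max_{j\in[J]}Q_j(\hat Z_s(\eta),\theta)+\max_{j\in[J]}\rho\big(a_j(\theta)^\top a_j(\theta)+c_j(\theta)\big).$$ For $\mu>0$ the smoothed risk is $$\mathbb J^\mu_\eta(\theta)=\mu\sum_{s\in[S]}\hat p_s(\eta)\log\Big(\sum_{j\in[J]}e^{Q_j(\hat Z_s(\eta),\theta)/\mu}\Big)+\mu\log\Big(\sum_{j\in[J]}e^{\rho(a_j(\theta)^\top a_j(\theta)+c_j(\theta))/\mu}\Big),$$ and $\theta^\mu_{\mathrm{RPS}}$ is the stable point of the smoothed risk: $\theta^\mu_{\mathrm{RPS}}\in\arg\min_{\theta\in\Theta}\mathbb J^\mu_{\theta^\mu_{\mathrm{RPS}}}(\theta)$. Model 3. $\mathcal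 Z\subseteq\mathbb R^m$ is nonempty, convex and closed, scenarios lie in $\mathcal Z$, $\ell(\cdot,\theta)$ is proper, concave and upper semicontinuous for every $\theta$, and $\Theta$ is bounded. Type-2 Wasserstein ball with Euclidean ground cost. For $\bar\theta=(\theta,\lambda)\in\Theta\times\mathbb R_+$ and $\tau>0$, $$\mathbb J_\eta(\bar\theta)=\sum_{s\in[S]}\hat p_s(\eta)\sup_{z\in\mathcal Z}\big(\ell(z,\theta)-\lambda\|z-\hat z_s(\eta)\|_2^2\big)+\rho^2\lambda,\qquad\mathbb J^\tau_\eta(\bar\theta)=\mathbb J_\eta(\bar\theta)+\tau\lambda^2,$$ with $\mathbb J_\eta(\theta)=\inf_{\lambda\ge0}\mathbb J_\eta(\theta,\lambda)$. Here $\bar\theta_{\mathrm{RPO}}=(\theta_{\mathrm{RPO}},\lambda_{\mathrm{RPO}})$ minimizes $(\theta,\lambda)\mapsto\mathbb J_\theta(\theta,\lambda)$ over $\Theta\times\mathbb R_+$, and $\bar\theta^\tau_{\mathrm{RPS}}=(\theta^\tau_{\mathrm{RPS}},\lambda^\tau_{\mathrm{RPS}})\in\arg\min_{\bar\theta\in\Theta\times\mathbb R_+}\mathbb J^\tau_{\theta^\tau_{\mathrm{RPS}}}(\bar\theta)$. $D=\sup_{z,z'\in\mathcal Z}\|z-z'\|_2$. *)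

(* Defs.v *)
From HB Require Import structures.
From mathcomp Require Import all_boot all_order all_algebra.
From mathcomp Require Import all_classical all_reals all_analysis.

Set Implicit Arguments.
Unset Strict Implicit.
Unset Printing Implicit Defensive.

Import Order.TTheory GRing.Theory Num.Theory.
Import numFieldNormedType.Exports.

Local Open Scope classical_set_scope.
Local Open Scope ring_scope.

Section Linear.
Context {R : realType}.

(* Frobenius norm; on column vectors it is the Euclidean norm. The library's
   norm on matrices is the max-norm, which is only used here through the
   topology, differentiability and boundedness it induces. *)
Definition normF {m n} (A : 'M[R]_(m, n)) : R :=
  Num.sqrt (\sum_i \sum_j A i j ^+ 2).

Definition dotc {n} (u v : 'cV[R]_n) : R := (u^T *m v) 0 0.

Definition quadf {n} (A : 'M[R]_n) (x : 'cV[R]_n) : R := dotc x (A *m x).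

Definition psdmx {n} (A : 'M[R]_n) : Prop :=
  A \is symmetricmx /\ forall x, 0 <= quadf A x.

Definition pdmx {n} (A : 'M[R]_n) : Prop :=
  A \is symmetricmx /\ forall x, x != 0 -> 0 < quadf A x.

Definition lambda_min {n} (A : 'M[R]_n) : R := inf [set a : R | eigenvalue A a].

(* For 0 < n these are a maximum and a minimum over a finite nonempty set. *)
Definition fmax {n} (f : 'I_n -> R) : R := sup (range f).
Definition fmin {n} (f : 'I_n -> R) : R := inf (range f).

Definition gradient {d} (f : 'cV[R]_d -> R) (x : 'cV[R]_d) : 'cV[R]_d :=
  \col_i ('D_(delta_mx i 0) (f : 'cV[R]_d -> R^o) x).

Definition distances {m} (A : set 'cV[R]_m) : set R :=
  [set normF (u.1 - u.2) | u in A `*` A].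

Definition finite_diameter {m} (A : set 'cV[R]_m) := has_ubound (distances A).

Definition diameter {m} (A : set 'cV[R]_m) : R := sup (distances A).

Definition upper_semicontinuous_on {m} (A : set 'cV[R]_m) (f : 'cV[R]_m -> R) :=
  forall x (a : R), A x -> f x < a ->
    \forall y \near within A (nbhs x), f y < a.

Definition argmin {T : Type} (A : set T) (f : T -> R) : set T :=
  [set x | A x /\ forall y, A y -> f x <= f y].

End Linear.

Section Loss.
Context {R : realType} {k l d : nat}.
Implicit Types (Xi : set 'M[R]_(k, l)) (Theta : set 'cV[R]_d).
Implicit Types (ell : 'M[R]_(k, l) -> 'cV[R]_d -> R).

(* [Xi] is the set of values of the random parameter. Differentiability, which
   the use of gradients presupposes, is only required on [Theta]. *)

Definition loss_convex Xi Theta ell := forall z, Xi z ->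
  convex_function (Theta : set (convex_lmodType 'cV[R]_d)) (ell z).

Definition loss_differentiable Xi Theta ell := forall z theta,
  Xi z -> Theta theta -> differentiable (ell z : 'cV[R]_d -> R^o) theta.

Definition strongly_convex Xi Theta (gamma : R) ell :=
  forall z theta theta', Xi z -> Theta theta -> Theta theta' ->
  ell z theta' + dotc (gradient (ell z) theta') (theta - theta')
    + gamma / 2 * normF (theta - theta') ^+ 2 <= ell z theta.

Definition smooth_loss Xi Theta (beta : R) ell :=
  forall z z' theta, Xi z -> Xi z' -> Theta theta ->
  normF (gradient (ell z) theta - gradient (ell z') theta)
    <= beta * normF (z - z').

Definition lipschitz_param Xi Theta (Lz : R) ell :=
  forall z z' theta, Xi z -> Xi z' -> Theta theta ->
  `|ell z theta - ell z' theta| <= Lz * normF (z - z').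

Definition lipschitz_decision Xi Theta (Lt : R) ell :=
  forall z theta theta', Xi z -> Theta theta -> Theta theta' ->
  `|ell z theta - ell z theta'| <= Lt * normF (theta - theta').

End Loss.

(* A distribution with [S] weighted scenarios, not necessarily distinct. *)
Record scen_dist (R : realType) (S k l : nat) := ScenDist {
  weight : 'I_S -> R;
  scen : 'I_S -> 'M[R]_(k, l);
  weight_ge0 : forall s, 0 <= weight s;
  weight_sum1 : \sum_s weight s = 1
}.

Notation borel_mx R k l := (g_sigma_algebraType (@open 'M[R]_(k, l))).

Section Law.
Context {R : realType} {S k l : nat} (P : scen_dist R S k l).
Local Open Scope ereal_scope.

Definition scen_law (A : set (borel_mx R k l)) : \bar R :=
  \sum_(s < S) (weight P s)%:E * \d_(scen P s : borel_mx R k l) A.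

Let law0 : scen_law set0 = 0.
Proof. by rewrite /scen_law big1// => s _; rewrite measure0 mule0. Qed.

Let law_ge0 A : 0 <= scen_law A.
Proof.
by apply: sume_ge0 => s _; rewrite mule_ge0// lee_fin; exact: weight_ge0.
Qed.

Let law_sigma_additive : semi_sigma_additive scen_law.
Proof.
pose m n : {measure set (borel_mx R k l) -> \bar R} :=
  if insub n is Some s
  then mscale (NngNum (weight_ge0 P s)) \d_(scen P s : borel_mx R k l)
  else mzero.
have -> : scen_law = msum m S; last exact: measure_semi_sigma_additive.
by apply/funext => A; apply: eq_bigr => s _; rewrite /m valK.
Qed.

HB.instance Definition _ := isMeasure.Build _ _ _ scen_law
  law0 law_ge0 law_sigma_additive.

Let law_setT : scen_law setT = 1.
Proof.
rewrite /scen_law -[RHS]/(1%R%:E) -(weight_sum1 P) -sumEFin.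
by apply: eq_bigr => s _; rewrite diracT mule1.
Qed.

HB.instance Definition _ := Measure_isProbability.Build _ _ _ scen_law law_setT.

End Law.

Section Wasserstein.
Context {R : realType} {k l : nat}.
Implicit Types mu nu : probability (borel_mx R k l) R.

Definition coupling mu nu :
    set (probability (borel_mx R k l * borel_mx R k l)%type R) :=
  [set pi | forall A, measurable A ->
     pi (A `*` setT) = mu A /\ pi (setT `*` A) = nu A].

Definition W1 mu nu : \bar R :=
  ereal_inf [set (\int[pi]_u (normF (u.1 - u.2 : 'M[R]_(k, l)))%:E)%E
            | pi in coupling mu nu].

End Wasserstein.

Section DistributionMap.
Context {R : realType} {S k l d : nat}.
Implicit Types (Theta : set 'cV[R]_d) (Phat : 'cV[R]_d -> scen_dist R S k l).

(* Only the values of a distribution map on [Theta] matter. *)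

Definition sensitive Theta (eps : R) Phat :=
  forall theta theta', Theta theta -> Theta theta' ->
  (W1 (scen_law (Phat theta)) (scen_law (Phat theta'))
     <= (eps * normF (theta - theta'))%:E)%E.

Definition scenarios Theta Phat : set 'M[R]_(k, l) :=
  [set z | exists theta s, Theta theta /\ z = scen (Phat theta) s].

Definition scen_support (P : scen_dist R S k l) : set 'M[R]_(k, l) :=
  [set z | exists s, 0 < weight P s /\ z = scen P s].

Definition scen_mean (P : scen_dist R S k l) (f : 'M[R]_(k, l) -> R) : R :=
  \sum_s weight P s * f (scen P s).

End DistributionMap.

Definition sym_params (R : realType) (n : nat) : set 'M[R]_n :=
  [set Z | Z \is symmetricmx].
Arguments sym_params : clear implicits.

(* In the first two models the random parameter (Y, z, z0) is the symmetric
   block matrix with Y = ulsubmx, z = ursubmx and z0 = drsubmx. *)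

Section QuadraticLoss.
Context {R : realType} {d S : nat}.

Definition quad_loss (cL : R -> R) (Z : 'M[R]_(d + 1)) (theta : 'cV[R]_d) : R :=
  cL (quadf (ulsubmx Z) theta + 2 * dotc (ursubmx Z) theta + drsubmx Z 0 0).

Definition quad_risk (cL : R -> R) (L rho : R)
    (P : scen_dist R S (d + 1) (d + 1)) (theta : 'cV[R]_d) : R :=
  scen_mean P (fun Z => quad_loss cL Z theta)
  + rho * L * normF (col_mx theta (1%:M : 'M[R]_1)) ^+ 2.

End QuadraticLoss.

Section PiecewiseQuadraticLoss.
Context {R : realType} {d N J S : nat}.

Record pwq_data := PwqData {
  abar : 'I_J -> 'cV[R]_N;
  Abar : 'I_J -> 'M[R]_(N, d);
  bbar : 'I_J -> 'cV[R]_N;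
  Bbar : 'I_J -> 'M[R]_(N, d);
  cbar0 : 'I_J -> R;
  cbar : 'I_J -> 'cV[R]_d
}.

Variable D : pwq_data.
Implicit Types (j : 'I_J) (theta : 'cV[R]_d) (Z : 'M[R]_(N + 1)).

Definition pwq_a j theta : 'cV[R]_N := abar D j + Abar D j *m theta.
Definition pwq_b j theta : 'cV[R]_N := bbar D j + Bbar D j *m theta.
Definition pwq_c j theta : R := cbar0 D j + dotc (cbar D j) theta.

Definition pwq_piece j Z theta : R :=
  quadf (ulsubmx Z) (pwq_a j theta) + 2 * dotc (pwq_b j theta) (ursubmx Z)
  + pwq_c j theta * drsubmx Z 0 0.

Definition pwq_loss Z theta : R := fmax (fun j => pwq_piece j Z theta).

Definition pwq_reg (rho : R) j theta : R :=
  rho * (dotc (pwq_a j theta) (pwq_a j theta) + pwq_c j theta).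

Definition pwq_risk (rho : R) (P : scen_dist R S (N + 1) (N + 1)) theta : R :=
  scen_mean P (fun Z => pwq_loss Z theta) + fmax (pwq_reg rho ^~ theta).

Definition pwq_risk_smooth (mu rho : R) (P : scen_dist R S (N + 1) (N + 1))
    theta : R :=
  mu * scen_mean P
         (fun Z => ln (\sum_j expR (pwq_piece j Z theta / mu)))
  + mu * ln (\sum_j expR (pwq_reg rho j theta / mu)).

Definition pwq_alpha : R :=
  2 * fmin (fun j => lambda_min ((Abar D j)^T *m Abar D j)).

End PiecewiseQuadraticLoss.
Arguments pwq_data : clear implicits.

Section ConcaveLoss.
Context {R : realType} {d m S : nat}.
Variables (Zset : set 'cV[R]_m) (ell : 'cV[R]_m -> 'cV[R]_d -> R).

(* The decision is the pair (theta, lambda). The supremum is that of a real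
   set, which is bounded above when [ell] is and lambda is nonnegative. *)
Definition conc_risk (rho : R) (P : scen_dist R S m 1) (tb : 'cV[R]_d * R) : R :=
  scen_mean P (fun zhat =>
    sup [set ell z tb.1 - tb.2 * normF (z - zhat) ^+ 2 | z in Zset])
  + rho ^+ 2 * tb.2.

Definition conc_risk_reg (tau rho : R) (P : scen_dist R S m 1)
    (tb : 'cV[R]_d * R) : R :=
  conc_risk rho P tb + tau * tb.2 ^+ 2.

End ConcaveLoss.

Definition lambda_bar {R : realType} (tau rho lo hi : R) : R :=
  (Num.sqrt (rho ^+ 4 + 4 * tau * (hi - lo)) - rho ^+ 2) / (2 * tau).

(* Main.v *)
Require Import Defs.
From mathcomp Require Import all_boot all_order all_algebra.
From mathcomp Require Import all_classical all_reals all_analysis.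
From mathcomp Require Import measurable_realfun ring lra.

Set Implicit Arguments.
Unset Strict Implicit.
Unset Printing Implicit Defensive.

Import Order.TTheory GRing.Theory Num.Theory.
Import numFieldNormedType.Exports.

Local Open Scope classical_set_scope.
Local Open Scope ring_scope.

(** Write J(eta, theta) for the decoupled risk, s for the stable decision and o
    for the optimal one. All three bounds compare the two decisions through the
    mixed value J(s, o).

    - Growth. theta |-> J(s, theta) is strongly convex with some modulus c and
      minimal at s, so J(s, s) + c/2 |s - o|^2 <= J(s, o) ([argmin_growth]).
    - Shift. J(s, o) and J(o, o) differ only in the distribution under which one
      and the same Lipschitz function is averaged, so sensitivity gives
      J(s, o) - J(o, o) <= K eps |s - o|. This is the easy half of
      Kantorovich duality ([scen_mean_lipschitz], [scen_mean_shift]).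

    Adding up and maximizing k r - c/2 r^2 over r = |s - o| leaves k^2 / (2 c)
    ([performative_gap]), a quarter of 2 k^2 / c.

    Strong convexity is used in Jensen form: in the gradient inequality based at
    a point of the segment, the linear terms cancel between the two endpoints
    ([strongly_convex_jensen]), and at the minimizer only values of the risk are
    compared.

    Quadratic loss: the regularizer rho L (|theta|^2 + 1) adds 2 rho L to the
    modulus gamma.

    Piecewise quadratic loss: the modulus rho alpha comes from the second term
    alone, since log-sum-exp preserves Jensen-type strong convexity
    ([lse_jensen]) and 2 |A x|^2 >= alpha |x|^2 by the Rayleigh principle
    ([lambda_min_pd]). Replacing log-sum-exp by the maximum costs mu ln J twice
    ([lse_le_fmax]), and the hypothesis on mu turns this into a multiple of
    |s - o|, which joins the Lipschitz constant in k.

    Concave loss: the inner supremum is a sup-convolution of the loss with a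
    quadratic, jointly convex in (theta, lambda) and 2 Lz-Lipschitz in the
    scenario ([envelope_lipschitz]); with k = 2 eps Lz the general argument
    gives 2 (eps Lz)^2 / gamma, which is absorbed by the term eps Lz of the
    last factor. It also costs tau lambda_o^2, where lambda_o is the optimal
    multiplier. If lambda_o <= lambda_bar this is what is wanted. Nothing forces
    that inequality, because lambda_o minimizes the risk without its tau-term;
    but if it fails then the multiplier 0 is a good enough competitor: it gives
    J(s, s) <= hi, while J(o, o) >= lo + rho^2 lambda_o, and
    hi - lo = tau lambda_bar^2 + rho^2 lambda_bar ([lambda_barP]). *)

(** * Euclidean and Frobenius norms *)
Section DotProduct.
Context {R : realType}.

Lemma normF_ge0 {m n} (A : 'M[R]_(m, n)) : 0 <= normF A.
Proof. exact: sqrtr_ge0. Qed.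

Lemma dotcE {n} (u v : 'cV[R]_n) : dotc u v = \sum_i u i 0 * v i 0.
Proof. by rewrite /dotc mxE; apply: eq_bigr => i _; rewrite mxE. Qed.

Lemma dotcC {n} (u v : 'cV[R]_n) : dotc u v = dotc v u.
Proof. by rewrite !dotcE; apply: eq_bigr => i _; rewrite mulrC. Qed.

Lemma dotcDr {n} (u v w : 'cV[R]_n) : dotc u (v + w) = dotc u v + dotc u w.
Proof. by rewrite /dotc mulmxDr mxE. Qed.

Lemma dotcZr {n} a (u v : 'cV[R]_n) : dotc u (a *: v) = a * dotc u v.
Proof. by rewrite /dotc -scalemxAr mxE. Qed.

Lemma dotcDl {n} (u v w : 'cV[R]_n) : dotc (v + w) u = dotc v u + dotc w u.
Proof. by rewrite !(dotcC _ u) dotcDr. Qed.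

Lemma dotcZl {n} a (u v : 'cV[R]_n) : dotc (a *: v) u = a * dotc v u.
Proof. by rewrite !(dotcC _ u) dotcZr. Qed.

Lemma dotcNr {n} (u v : 'cV[R]_n) : dotc u (- v) = - dotc u v.
Proof. by rewrite -scaleN1r dotcZr mulN1r. Qed.

Lemma dotcNl {n} (u v : 'cV[R]_n) : dotc (- v) u = - dotc v u.
Proof. by rewrite !(dotcC _ u) dotcNr. Qed.

Definition dotc_lin := (@dotcDl, @dotcDr, @dotcZl, @dotcZr, @dotcNl, @dotcNr).

Lemma normF_sqr {m n} (A : 'M[R]_(m, n)) :
  normF A ^+ 2 = \sum_i \sum_j A i j ^+ 2.
Proof.
by rewrite sqr_sqrtr// sumr_ge0// => i _; rewrite sumr_ge0// => j _; rewrite sqr_ge0.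
Qed.

Lemma normF_dotc {n} (u : 'cV[R]_n) : normF u ^+ 2 = dotc u u.
Proof. by rewrite normF_sqr dotcE; apply: eq_bigr => i _; rewrite big_ord1. Qed.

Lemma normF0 {m n} : normF (0 : 'M[R]_(m, n)) = 0.
Proof.
rewrite /normF big1 ?sqrtr0// => i _; rewrite big1// => j _.
by rewrite mxE expr0n.
Qed.

Lemma normF_eq0 {n} (u : 'cV[R]_n) : normF u = 0 -> u = 0.
Proof.
move=> u0; apply/colP => i; rewrite mxE; apply/eqP; rewrite -sqrf_eq0.
have := normF_dotc u; rewrite u0 expr0n/= dotcE => /esym/eqP.
by rewrite psumr_eq0 => [/allP/(_ i (mem_index_enum i))|j _]; rewrite -expr2 ?sqr_ge0.
Qed.

(** Expanding the square of |v| u - |u| v gives 2 |u| |v| (|u| |v| - <u, v>). *)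
Lemma dotc_le_normF {n} (u v : 'cV[R]_n) : dotc u v <= normF u * normF v.
Proof.
have [/normF_eq0 ->|u0] := eqVneq (normF u) 0.
  by rewrite -(scale0r u) dotcZl mul0r mulr_ge0// normF_ge0.
have [/normF_eq0 ->|v0] := eqVneq (normF v) 0.
  by rewrite -(scale0r u) dotcZr mul0r mulr_ge0// normF_ge0.
have uv : 0 < normF u * normF v by rewrite lt_def mulf_neq0//= mulr_ge0// normF_ge0.
have : 0 <= normF (normF v *: u - normF u *: v) ^+ 2 by rewrite sqr_ge0.
rewrite normF_dotc !dotc_lin -!normF_dotc (dotcC v u).
rewrite [X in 0 <= X](_ : _ =
  2 * (normF u * normF v) * (normF u * normF v - dotc u v)); last by ring.
have uv2 : 0 < 2 * (normF u * normF v) by rewrite mulr_gt0.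
by rewrite (pmulr_rge0 _ uv2) subr_ge0.
Qed.

Lemma normF_triangle {n} (u v : 'cV[R]_n) : normF (u + v) <= normF u + normF v.
Proof.
rewrite -ler_sqr ?nnegrE ?addr_ge0 ?normF_ge0// sqrrD !normF_dotc !dotc_lin.
by rewrite (dotcC v u) mulr2n; have := dotc_le_normF u v; lra.
Qed.

Lemma quadf_jensen {n} (A : 'M[R]_n) t (u v : 'cV[R]_n) :
  quadf A ((1 - t) *: u + t *: v) =
  (1 - t) * quadf A u + t * quadf A v - t * (1 - t) * quadf A (u - v).
Proof.
by rewrite /quadf !(mulmxDr, mulmxN) -!scalemxAr !dotc_lin; ring.
Qed.

Lemma quadf1 {n} (x : 'cV[R]_n) : quadf 1%:M x = normF x ^+ 2.
Proof. by rewrite /quadf mul1mx normF_dotc. Qed.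

End DotProduct.

(** * Strong convexity without derivatives *)

Section StrongConvexity.
Context {R : realType} {d : nat}.
Implicit Types (Theta : set 'cV[R]_d) (f : 'cV[R]_d -> R).

(** [c] is normalized as in the gradient inequality: the correction is
    c/2 times the squared distance. *)
Definition strongly_jensen Theta (c : R) f := forall t x y,
  0 < t < 1 -> Theta x -> Theta y ->
  f ((1 - t) *: x + t *: y) <=
  (1 - t) * f x + t * f y - t * (1 - t) * (c / 2 * normF (x - y) ^+ 2).

Lemma convex_set_comb Theta t x y :
  convex_set (Theta : set (convex_lmodType 'cV[R]_d)) ->
  0 < t < 1 -> Theta x -> Theta y -> Theta ((1 - t) *: x + t *: y).
Proof.
move=> cT /andP[t0 t1] Tx Ty.
have := cT y x (Itv01 (ltW t0) (ltW t1)); rewrite !inE => /(_ Ty Tx).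
by rewrite addrC.
Qed.

(** Cancel t and let t tend to 0; no limit is taken, since a single t with
    t |c| smaller than the putative excess gives a contradiction. *)
Lemma jensen_limit (a b c : R) :
  (forall t, 0 < t < 1 -> a <= (1 - t) * a + t * b - t * (1 - t) * c) ->
  a + c <= b.
Proof.
move=> H; rewrite leNgt; apply/negP => ab.
pose e := a + c - b; have e0 : 0 < e by rewrite /e; lra.
pose t := e / (2 * e + 2 * `|c|).
have D0 : 0 < 2 * e + 2 * `|c| by have := normr_ge0 c; lra.
have t0 : 0 < t by rewrite divr_gt0.
have t1 : t < 1 by rewrite ltr_pdivrMr// mul1r; have := normr_ge0 c; lra.
have := H t; rewrite t0 t1 => /(_ isT) Ht.
have {}Ht : t * e <= t * (t * c) by rewrite /e; lra.
rewrite ler_pM2l// in Ht.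
have : t * c <= t * `|c| by rewrite ler_wpM2l ?ler_norm// ltW.
have : t * (2 * e + 2 * `|c|) = e by rewrite /t divfK// gt_eqF.
have : 0 < t * e by rewrite mulr_gt0.
lra.
Qed.

(** Compare the minimizer with points of the segment towards the competitor. *)
Lemma argmin_growth Theta c f x y :
  convex_set (Theta : set (convex_lmodType 'cV[R]_d)) -> strongly_jensen Theta c f ->
  argmin Theta f x -> Theta y -> f x + c / 2 * normF (x - y) ^+ 2 <= f y.
Proof.
move=> cT jf [Tx xmin] Ty; apply: jensen_limit => t t01.
by apply: le_trans (jf t x y t01 Tx Ty); apply: xmin; exact: convex_set_comb.
Qed.

(** Both endpoints are compared with the point between them. The directions
    are t (x - y) and - (1 - t) (x - y), so the weighted gradient terms cancel
    whatever the gradient is. *)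
Lemma strongly_convex_jensen {k l} (Xi : set 'M[R]_(k, l)) Theta gamma ell z :
  convex_set (Theta : set (convex_lmodType 'cV[R]_d)) ->
  strongly_convex Xi Theta gamma ell -> Xi z -> strongly_jensen Theta gamma (ell z).
Proof.
move=> cT sc Xz t x y t01 Tx Ty.
set w := _ + _; have Tw : Theta w by exact: convex_set_comb.
have Hx := sc z x w Xz Tx Tw; have Hy := sc z y w Xz Ty Tw.
have xw : x - w = t *: (x - y).
  by rewrite /w; apply/matrixP => i j; rewrite !mxE; ring.
have yw : y - w = - (1 - t) *: (x - y).
  by rewrite /w; apply/matrixP => i j; rewrite !mxE; ring.
rewrite xw !normF_dotc !dotc_lin in Hx; rewrite yw !normF_dotc !dotc_lin in Hy.
rewrite !normF_dotc !dotc_lin; case/andP: t01 => t0 t1.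
set gx := dotc _ x in Hx Hy; set gy := dotc _ y in Hx Hy.
have t1' : 0 <= 1 - t by rewrite subr_ge0 ltW.
apply: le_trans _ (lerB (lerD (ler_wpM2l t1' Hx) (ler_wpM2l (ltW t0) Hy)) (lexx _)).
by rewrite le_eqVlt; apply/orP; left; apply/eqP; field.
Qed.

Lemma jensenD Theta c1 c2 f g :
  strongly_jensen Theta c1 f -> strongly_jensen Theta c2 g -> strongly_jensen Theta (c1 + c2) (f \+ g).
Proof.
move=> jf jg t x y t01 Tx Ty /=.
apply: le_trans (lerD (jf t x y t01 Tx Ty) (jg t x y t01 Tx Ty)) _.
by rewrite le_eqVlt; apply/orP; left; apply/eqP; field.
Qed.

Lemma jensenZ Theta a c f :
  0 <= a -> strongly_jensen Theta c f -> strongly_jensen Theta (a * c) (fun x => a * f x).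
Proof.
move=> a0 jf t x y t01 Tx Ty; apply: le_trans (ler_wpM2l a0 (jf t x y t01 Tx Ty)) _.
by rewrite le_eqVlt; apply/orP; left; apply/eqP; field.
Qed.

Lemma jensen_of_affine Theta f :
  (forall t x y, f ((1 - t) *: x + t *: y) = (1 - t) * f x + t * f y) ->
  strongly_jensen Theta 0 f.
Proof. by move=> fE t x y _ _ _; rewrite fE !mul0r mulr0 subr0. Qed.

Lemma affine_comb {n} (u : 'cV[R]_n) (B : 'M[R]_(n, d)) t x y :
  u + B *m ((1 - t) *: x + t *: y) =
  (1 - t) *: (u + B *m x) + t *: (u + B *m y).
Proof.
rewrite mulmxDr -!scalemxAr !scalerDr addrACA -scalerDl.
by rewrite (_ : 1 - t + t = 1) ?scale1r//; ring.
Qed.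

Lemma jensen_affine_quadf {n} Theta (A : 'M[R]_n)
    (u : 'cV[R]_n) (B : 'M[R]_(n, d)) c :
  (forall x, c * normF x ^+ 2 <= 2 * quadf A (B *m x)) ->
  strongly_jensen Theta c (fun x => quadf A (u + B *m x)).
Proof.
move=> cA t x y /andP[t0 t1] _ _.
rewrite affine_comb quadf_jensen.
have -> : u + B *m x - (u + B *m y) = B *m (x - y).
  by rewrite opprD addrACA subrr add0r mulmxBr.
have tt : 0 <= t * (1 - t) by apply: mulr_ge0; rewrite ?subr_ge0 ltW.
rewrite lerD2l lerN2 ler_wpM2l//.
have := cA (x - y); lra.
Qed.

Lemma jensen_scen_mean {S k l} Theta c (P : scen_dist R S k l)
    (g : 'M[R]_(k, l) -> 'cV[R]_d -> R) :
  (forall s, strongly_jensen Theta c (g (scen P s))) ->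
  strongly_jensen Theta c (fun x => scen_mean P (fun z => g z x)).
Proof.
move=> jg t x y t01 Tx Ty; rewrite /scen_mean.
set K := t * _ * _; have -> : K = \sum_s weight P s * K.
  by rewrite -mulr_suml weight_sum1 mul1r.
rewrite !mulr_sumr -sumrN -!big_split/=.
apply: ler_sum => s _.
apply: le_trans (ler_wpM2l (weight_ge0 P s) (jg s t x y t01 Tx Ty)) _.
by rewrite -/K le_eqVlt; apply/orP; left; apply/eqP; ring.
Qed.

(** Growth at rate c against a linear shift of slope k: complete the square in
    the distance r. *)
Lemma performative_gap (c k a b v r : R) : 0 < c ->
  a + c / 2 * r ^+ 2 <= b -> b - v <= k * r -> a - v <= k ^+ 2 / (2 * c).
Proof.
move=> c0 ab bv.
have : 0 <= c / 2 * (r - k / c) ^+ 2.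
  by apply: mulr_ge0; rewrite ?sqr_ge0// divr_ge0// ltW.
have -> : c / 2 * (r - k / c) ^+ 2 =
  c / 2 * r ^+ 2 - k * r + k ^+ 2 / (2 * c).
  by field; rewrite gt_eqF.
lra.
Qed.

Lemma sqr_div_le (c k : R) : 0 < c -> k ^+ 2 / (2 * c) <= 2 * k ^+ 2 / c.
Proof.
move=> c0; have c20 : 0 < 2 * c by rewrite mulr_gt0.
rewrite ler_pdivrMr// (_ : 2 * k ^+ 2 / c * (2 * c) = 4 * k ^+ 2).
  by have := sqr_ge0 k; lra.
by field; rewrite gt_eqF.
Qed.

End StrongConvexity.

(** * Kantorovich bound for distributions with finitely many scenarios *)

Section Coupling.
Context {R : realType} {k l : nat}.
Local Notation M := 'M[R]_(k, l).
Local Notation B := (borel_mx R k l).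

Lemma measurable_set1_mx (a : M) : measurable ([set a] : set B).
Proof.
rewrite -(setCK [set a]); apply: measurableC; apply: sub_sigma_algebra.
rewrite /= openC; apply: accessible_closed_set1; apply: hausdorff_accessible.
exact: norm_hausdorff.
Qed.

Lemma measurable_finite_mx (s : seq M) : measurable ([set` s] : set B).
Proof.
have -> : [set` s] = \big[setU/set0]_(a <- s) [set a].
  by rewrite -bigcup_seq; apply/seteqP; split => [a ?|a [b ? ->//]]; exists a.
by apply: bigsetU_measurable => a _; exact: measurable_set1_mx.
Qed.

Lemma measurable_coord i j : measurable_fun setT (fun A : B => (A : M) i j).
Proof.
apply: (measurability _ (RGenOInfty.measurableE R)) => _ [_ [x ->] <-].
rewrite setTI; apply: sub_sigma_algebra => /=.
rewrite -[X in open X]/((fun A : M => A i j) @^-1` `]x, +oo[%classic).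
by apply: open_comp => [A _|]; [exact: coord_continuous|exact: rray_open].
Qed.

(** Matrix entries are Borel functions of either factor, and the distance is a
    real expression in finitely many of them. *)
Lemma measurable_dist :
  measurable_fun setT (fun u : B * B => (normF (u.1 - u.2 : M))%:E).
Proof.
apply/measurable_EFinP; apply: (measurableT_comp
  (continuous_measurable_fun (@sqrt_continuous R))).
apply: measurable_sum => i; apply: measurable_sum => j.
under eq_fun do rewrite !mxE.
apply: measurable_funX; apply: measurable_funB.
- by apply: (measurableT_comp (measurable_coord i j)); exact: measurable_fst.
- by apply: (measurableT_comp (measurable_coord i j)); exact: measurable_snd.
Qed.

Variables mu nu : probability B R.
Variables (F : seq M) (F_uniq : uniq F).

Lemma measure_bigsetU_seq {d} {T : measurableType d}
    (m : {measure set T -> \bar R}) {I : eqType} (E : I -> set T) (s : seq I) :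
  (forall i, measurable (E i)) -> uniq s -> trivIset [set` s] E ->
  m (\big[setU/set0]_(i <- s) E i) = (\sum_(i <- s) m (E i))%E.
Proof.
move=> mE us tE; have mD : measurable (\big[setU/set0]_(i <- s) E i).
  by apply: bigsetU_measurable => i _.
rewrite -[LHS]mul1e -integral_cst// ge0_integral_bigsetU//.
by apply: eq_bigr => i _; rewrite integral_cst// mul1e.
Qed.

(** If [g] lies in the finite set [F] almost everywhere, its fibres over [F]
    cut every measurable set into pieces carrying its whole measure. Applied to
    the two projections, it shows that a coupling of finitely supported laws is
    determined by a finite matrix of masses. *)
Lemma measure_fibers {d} {T : measurableType d} (m : {measure set T -> \bar R})
    (g : T -> B) A : measurable_fun setT g ->
  m (g @^-1` (~` [set` F])) = 0%E -> measurable A ->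
  m A = (\sum_(b <- F) m (A `&` g @^-1` [set b]))%E.
Proof.
move=> mg gF mA; have mF := measurable_finite_mx F.
have mP (C : set B) : measurable C -> measurable (g @^-1` C).
  by move=> mC; rewrite -[X in measurable X]setTI; exact: mg.
have mE b : measurable (A `&` g @^-1` [set b]).
  by apply: measurableI => //; apply: mP; exact: measurable_set1_mx.
rewrite -measure_bigsetU_seq//; last first.
  by move=> b b' _ _ [u [[/= _ <-]]] [].
rewrite -bigcup_seq -[in LHS](setIT A).
have -> : A `&` setT = \bigcup_(b in [set` F]) (A `&` g @^-1` [set b])
    `|` A `&` g @^-1` (~` [set` F]).
  apply/seteqP; split => [u [Au _]|u [[b _ [Au _]]|[Au _]]]//.
  by have [Fu|Fu] := pselect ([set` F] (g u)); [left; exists (g u)|right].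
rewrite measureU0//.
- by rewrite bigcup_seq; apply: bigsetU_measurable => b _; exact: mE.
- by apply: measurableI => //; apply: mP; exact: measurableC.
- have mN : measurable (g @^-1` (~` [set` F])) by apply: mP; exact: measurableC.
  by apply: subset_measure0 gF => //; exact: measurableI.
Qed.

Lemma coupling_row (pi : probability (B * B)%type R) A :
  coupling mu nu pi -> nu (~` [set` F]) = 0%E -> measurable A ->
  mu A = (\sum_(b <- F) pi (A `*` [set b]))%E.
Proof.
move=> cpl nuF mA; rewrite -(cpl A mA).1 (@measure_fibers _ _ _ snd)//.
- by apply: eq_bigr => b _; congr (pi _); apply/seteqP; split => [[u v] [[]]|[u v] []].
- rewrite -nuF -(cpl _ (measurableC (measurable_finite_mx F))).2; congr (pi _).
  by apply/seteqP; split => [[u v]|[u v] []].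
- exact: measurableX.
Qed.

Lemma coupling_col (pi : probability (B * B)%type R) A :
  coupling mu nu pi -> mu (~` [set` F]) = 0%E -> measurable A ->
  nu A = (\sum_(a <- F) pi ([set a] `*` A))%E.
Proof.
move=> cpl muF mA; rewrite -(cpl A mA).2 (@measure_fibers _ _ _ fst)//.
- by apply: eq_bigr => b _; congr (pi _); apply/seteqP; split => [[u v] [[]]|[u v] []].
- rewrite -muF -(cpl _ (measurableC (measurable_finite_mx F))).1; congr (pi _).
  by apply/seteqP; split => [[u v]|[u v] []].
- exact: measurableX.
Qed.

(** The integrand is constant on each atom, and the atoms are disjoint. *)
Lemma coupling_cost (pi : probability (B * B)%type R) :
  (\sum_(a <- F) \sum_(b <- F) (normF (a - b))%:E * pi ([set a] `*` [set b])
   <= \int[pi]_u (normF (u.1 - u.2 : M))%:E)%E.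
Proof.
pose s := [seq (a, b) | a <- F, b <- F] : seq (M * M)%type.
pose E p : set (B * B) := [set p.1] `*` [set p.2] .
have mE (p : M * M) : measurable (E p).
  by apply: measurableX; exact: measurable_set1_mx.
have mD : measurable (\big[setU/set0]_(p <- s) E p).
  by apply: bigsetU_measurable => p _.
apply: (@le_trans _ _ (\int[pi]_(u in \big[setU/set0]_(p <- s) E p)
  (normF (u.1 - u.2 : M))%:E)%E); last first.
  by apply: ge0_subset_integral => //; [exact: measurable_dist|
    move=> u _; rewrite lee_fin normF_ge0].
rewrite ge0_integral_bigsetU//.
- rewrite /s big_allpairs; apply: lee_sum => a _; apply: lee_sum => b _.
  rewrite -integral_cst; last exact: mE (a, b).
  rewrite le_eqVlt; apply/orP; left; apply/eqP.
  by apply: eq_integral => -[u v]; rewrite inE => -[/= -> ->].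
- by rewrite allpairs_uniq// => -[? ?] [? ?].
- move=> [a b] [a' b'] _ _ [[u v] [[/= -> ->]]] [/= -> ->] //.
- by apply: measurable_funS measurable_dist.
- by move=> u _; rewrite lee_fin normF_ge0.
Qed.
End Coupling.

Lemma scen_law_null {R : realType} {S k l} (P : scen_dist R S k l)
    (A : set 'M[R]_(k, l)) :
  (forall s, ~ A (scen P s)) -> scen_law P A = 0%E.
Proof.
move=> PA; rewrite /scen_law big1// => s _.
by rewrite diracE memNset ?mule0.
Qed.

(** Scenarios may be repeated, so the mean over labels is regrouped as a mean
    over values; only the latter is visible to couplings. *)
Lemma scen_meanE {R : realType} {S k l} (P : scen_dist R S k l)
    (F : seq 'M[R]_(k, l)) f : uniq F -> (forall s, scen P s \in F) ->
  scen_mean P f = \sum_(a <- F) f a * fine (scen_law P [set a]).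
Proof.
move=> uF PF; rewrite /scen_mean.
have E a : fine (scen_law P [set a]) = \sum_s weight P s * (a == scen P s)%:R.
  rewrite /scen_law.
  under eq_bigr => s _ do rewrite diracE in_set1 eq_sym -EFinM.
  by rewrite sumEFin.
under [RHS]eq_bigr => a _ do rewrite E mulr_sumr.
rewrite exchange_big/=; apply: eq_bigr => s _.
rewrite (bigD1_seq (scen P s))//= eqxx mulr1 mulrC big1 ?addr0// => a /negPf ->.
by rewrite !mulr0.
Qed.

(** The easy half of Kantorovich duality. For a coupling with masses q(a, b), the
    difference of means is the sum of q(a, b) (f a - f b), which is at most K
    times the transport cost. The function is only controlled on [X], hence the
    reduction to finite sums instead of integrals of [f]. *)
Lemma scen_mean_lipschitz {R : realType} {S k l} (P Q : scen_dist R S k l)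
    (X : set 'M[R]_(k, l)) f (K e : R) :
  (forall s, X (scen P s)) -> (forall s, X (scen Q s)) -> 0 <= K ->
  (forall a b, X a -> X b -> f a - f b <= K * normF (a - b)) ->
  (W1 (scen_law P) (scen_law Q) <= e%:E)%E ->
  scen_mean P f - scen_mean Q f <= K * e.
Proof.
move=> XP XQ K0 fL W.
pose F := undup (codom (scen P) ++ codom (scen Q)).
have uF : uniq F by exact: undup_uniq.
have PF s : scen P s \in F by rewrite mem_undup mem_cat codom_f.
have QF s : scen Q s \in F by rewrite mem_undup mem_cat codom_f orbT.
have FX a : a \in F -> X a.
  by rewrite mem_undup mem_cat => /orP[|] /codomP[s ->].
have cost pi : coupling (scen_law P) (scen_law Q) pi ->
    ((scen_mean P f - scen_mean Q f)%:E
     <= K%:E * \int[pi]_u (normF (u.1 - u.2 : 'M[R]_(k, l)))%:E)%E.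
  move=> cpl.
  have PF0 : scen_law P (~` [set` F]) = 0%E.
    by apply: scen_law_null => s; apply; exact: PF.
  have QF0 : scen_law Q (~` [set` F]) = 0%E.
    by apply: scen_law_null => s; apply; exact: QF.
  pose q a b : R := fine (pi ([set a] `*` [set b])).
  have qE a b : pi ([set a] `*` [set b]) = (q a b)%:E.
    rewrite fineK// fin_num_measure//.
    by apply: measurableX; exact: measurable_set1_mx.
  have rowE a : fine (scen_law P [set a]) = \sum_(b <- F) q a b.
    rewrite (coupling_row uF cpl QF0 (measurable_set1_mx a)).
    by under eq_bigr => b _ do rewrite qE; rewrite sumEFin.
  have colE b : fine (scen_law Q [set b]) = \sum_(a <- F) q a b.
    rewrite (coupling_col uF cpl PF0 (measurable_set1_mx b)).
    by under eq_bigr => a _ do rewrite qE; rewrite sumEFin.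
  apply: le_trans (lee_wpmul2l _ (coupling_cost uF pi)); last by rewrite lee_fin.
  under eq_bigr => a _ do under eq_bigr => b _ do rewrite qE -EFinM.
  under eq_bigr => a _ do rewrite sumEFin.
  rewrite sumEFin -EFinM lee_fin (scen_meanE f uF PF) (scen_meanE f uF QF).
  under eq_bigr => a _ do rewrite rowE mulr_sumr.
  under [X in _ - X]eq_bigr => b _ do rewrite colE mulr_sumr.
  rewrite [X in _ - X]exchange_big/= -sumrB mulr_sumr !big_seq.
  apply: ler_sum => a aF; rewrite -sumrB mulr_sumr !big_seq.
  apply: ler_sum => b bF; rewrite -mulrBl mulrA ler_wpM2r//.
    exact: fine_ge0.
  by apply: fL; exact: FX.
(* A nearly optimal coupling suffices; K + 1 instead of K allows K = 0. *)
apply/ler_addgt0Pr => eps eps0.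
have K1 : 0 < K + 1 by rewrite ltr_wpDl.
pose del := eps / (K + 1); have del0 : 0 < del by exact: divr_gt0.
have [_ [pi cpl <-] pilt] : exists2 x, [set (\int[pi]_u
    (normF (u.1 - u.2 : 'M[R]_(k, l)))%:E)%E | pi in
    coupling (scen_law P) (scen_law Q)] x & (x < (e + del)%:E)%E.
  by apply: ereal_inf_lt; apply: le_lt_trans W _; rewrite lte_fin ltrDl.
rewrite -lee_fin; apply: le_trans (cost _ cpl) _.
apply: le_trans (lee_wpmul2l _ (ltW pilt)) _; first by rewrite lee_fin.
rewrite -EFinM lee_fin mulrDr lerD2l /del mulrCA ger_pMr// ler_pdivrMr//.
by rewrite mul1r lerDl.
Qed.

Section Sensitivity.
Context {R : realType} {d S k l : nat}.

Lemma scen_mean_shift (Theta : set 'cV[R]_d) (Phat : 'cV[R]_d -> scen_dist R S k l)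
    (X : set 'M[R]_(k, l)) (f : 'M[R]_(k, l) -> R) K eps x y :
  sensitive Theta eps Phat -> scenarios Theta Phat `<=` X -> 0 <= K ->
  (forall z z', X z -> X z' -> f z - f z' <= K * normF (z - z')) ->
  Theta x -> Theta y ->
  scen_mean (Phat x) f - scen_mean (Phat y) f <= K * eps * normF (x - y).
Proof.
move=> sP sX K0 fL Tx Ty; rewrite -mulrA.
apply: (scen_mean_lipschitz (X := X)) => //; last exact: sP.
- by move=> s; apply: sX; exists x, s.
- by move=> s; apply: sX; exists y, s.
Qed.

Lemma lipschitz_param_sub (Theta : set 'cV[R]_d) (X : set 'M[R]_(k, l)) Lz ell theta :
  lipschitz_param X Theta Lz ell -> Theta theta ->
  forall z z', X z -> X z' -> ell z theta - ell z' theta <= Lz * normF (z - z').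
Proof. by move=> lp Tt z z' Xz Xz'; apply: le_trans (ler_norm _) (lp _ _ _ Xz Xz' Tt). Qed.

End Sensitivity.

(** * Quadratic loss composed with a Lipschitz function *)

Section QuadraticRisk.
Context {R : realType} {d : nat}.

Lemma lipschitz_constant_ge0 (cL : R -> R) L :
  (forall x y, `|cL x - cL y| <= L * `|x - y|) -> 0 <= L.
Proof.
move=> /(_ 1 0); rewrite subr0 normr1 mulr1; exact: le_trans (normr_ge0 _).
Qed.

Lemma normF_col_mx1 (x : 'cV[R]_d) :
  normF (col_mx x (1%:M : 'M[R]_1)) ^+ 2 = normF x ^+ 2 + 1.
Proof.
rewrite !normF_sqr big_split_ord/= big_ord1; congr (_ + _).
  by apply: eq_bigr => i _; apply: eq_bigr => j _; rewrite col_mxEu.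
by rewrite big_ord1 col_mxEd mxE eqxx expr1n.
Qed.

Lemma quad_risk_gap (Theta : set 'cV[R]_d) (rho : R)
    (Theta_convex : convex_set (Theta : set (convex_lmodType 'cV[R]_d)))
    (rho_gt0 : 0 < rho)
    (S : nat) (Phat : 'cV[R]_d -> scen_dist R S (d + 1) (d + 1))
    (Xi : set 'M[R]_(d + 1)) (cL : R -> R)
    (L gamma eps Lz : R) (theta_RPO theta_RPS : 'cV[R]_d) :
  scenarios Theta Phat `<=` Xi ->
  (forall x y, `|cL x - cL y| <= L * `|x - y|) ->
  0 < gamma -> strongly_convex Xi Theta gamma (quad_loss cL) ->
  sensitive Theta eps Phat ->
  0 <= Lz -> lipschitz_param Xi Theta Lz (quad_loss cL) ->
  argmin Theta (fun theta => quad_risk cL L rho (Phat theta) theta) theta_RPO ->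
  argmin Theta (quad_risk cL L rho (Phat theta_RPS)) theta_RPS ->
  quad_risk cL L rho (Phat theta_RPS) theta_RPS
    - quad_risk cL L rho (Phat theta_RPO) theta_RPO
  <= 2 * eps ^+ 2 * Lz ^+ 2 / (gamma + 2 * rho * L).
Proof.
move=> sXi lipL g0 sc sens Lz0 lip [To _] amin; have [Ts _] := amin.
have L0 := lipschitz_constant_ge0 lipL.
have jr : strongly_jensen Theta (gamma + 2 * rho * L) (quad_risk cL L rho (Phat theta_RPS)).
  apply: jensenD.
    apply: jensen_scen_mean => s; apply: strongly_convex_jensen sc _ => //.
    by apply: sXi; exists theta_RPS, s.
  rewrite -mulrA mulrC; apply: jensenZ; first by rewrite mulr_ge0// ltW.
  move=> t x y t01 Tx Ty; rewrite !normF_col_mx1 -!quadf1 quadf_jensen.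
  by rewrite le_eqVlt; apply/orP; left; apply/eqP; field.
rewrite -(mulrA 2) (mulrC (eps ^+ 2)) -exprMn.
have c0 : 0 < gamma + 2 * rho * L by rewrite ltr_wpDr// !mulr_ge0// ltW.
apply: le_trans (sqr_div_le _ c0).
apply: performative_gap c0 (argmin_growth Theta_convex jr amin To) _.
rewrite opprD addrACA subrr addr0.
apply: (scen_mean_shift sens sXi Lz0 _ Ts To).
exact: lipschitz_param_sub lip To.
Qed.

End QuadraticRisk.

(** * Log-sum-exp smoothing of a finite maximum *)

Section LogSumExp.
Context {R : realType} {J : nat}.
Implicit Types (f : 'I_J -> R) (mu : R).

Lemma le_fmax f j : f j <= fmax f.
Proof.
apply: ub_le_sup; last by exists j.
exists (\sum_i `|f i|) => _ [i _ <-]; apply: le_trans (ler_norm _) _.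
by rewrite (bigD1 i)//= lerDl sumr_ge0.
Qed.

Lemma fmin_le f j : f j >= fmin f.
Proof.
apply: ge_inf; last by exists j.
exists (- \sum_i `|f i|) => _ [i _ <-].
rewrite lerNl; apply: le_trans (ler_norm (- f i)) _.
by rewrite normrN (bigD1 i)//= lerDl sumr_ge0.
Qed.

Lemma fmin_attained f : (0 < J)%N -> exists j, fmin f = f j.
Proof.
move=> J0; pose j := [arg min_(i < Ordinal J0) f i]%O.
exists j; apply/eqP; rewrite eq_le fmin_le /=.
apply: lb_le_inf; first by exists (f j), j.
by move=> _ [i _ <-]; rewrite /j; case: arg_minP => // k _ /(_ i isT).
Qed.

Definition lse mu f : R := mu * ln (\sum_j expR (f j / mu)).

Lemma sum_expR_gt0 mu f : (0 < J)%N -> 0 < \sum_j expR (f j / mu).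
Proof.
move=> J0; rewrite (bigD1 (Ordinal J0))//= ltr_wpDr ?expR_gt0//.
by apply: sumr_ge0 => j _; exact: expR_ge0.
Qed.

(** Dividing by the exponential of M turns a bound on log-sum-exp into a bound
    on a sum of exponentials, which is the form that convexity of the
    exponential function can use. *)
Lemma lse_leP mu f M : (0 < J)%N -> 0 < mu ->
  (lse mu f <= M) = (\sum_j expR ((f j - M) / mu) <= 1).
Proof.
move=> J0 mu0; have S0 := sum_expR_gt0 mu f J0.
under eq_bigr => j _ do rewrite mulrBl expRD.
rewrite -mulr_suml expRN ler_pdivrMr ?expR_gt0// mul1r.
rewrite /lse mulrC -ler_pdivlMr// -[in RHS](lnK S0) ler_expR//.
Qed.

Lemma sum_expR_lse mu f : (0 < J)%N -> 0 < mu ->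
  \sum_j expR ((f j - lse mu f) / mu) = 1.
Proof.
move=> J0 mu0; have S0 := sum_expR_gt0 mu f J0.
under eq_bigr => j _ do rewrite mulrBl expRD.
rewrite -mulr_suml expRN /lse mulrAC divff ?gt_eqF// mul1r lnK ?posrE//.
by rewrite divff// gt_eqF.
Qed.

Lemma lse_le_fmax mu f : (0 < J)%N -> 0 < mu ->
  lse mu f <= fmax f + mu * ln J%:R.
Proof.
move=> J0 mu0; rewrite lse_leP//.
have JR : 0 < J%:R :> R by rewrite ltr0n.
apply: (@le_trans _ _ (\sum_(j < J) J%:R^-1)); last first.
  by rewrite sumr_const card_ord -(mulr_natl J%:R^-1) divff// gt_eqF.
apply: ler_sum => j _; rewrite -[in leRHS](lnK JR) -expRN ler_expR ler_pdivrMr//.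
by have := le_fmax f j; lra.
Qed.

(** Normalize the pieces by the values X and Y of log-sum-exp at the endpoints.
    Each exponential at the intermediate point is then bounded by the convex
    combination of those at the endpoints, and these add up to 1. *)
Lemma lse_jensen d (Theta : set 'cV[R]_d) c mu (f : 'I_J -> 'cV[R]_d -> R) :
  (0 < J)%N -> 0 < mu -> (forall j, strongly_jensen Theta c (f j)) ->
  strongly_jensen Theta c (fun x => lse mu (f ^~ x)).
Proof.
move=> J0 mu0 jf t x y t01 Tx Ty; rewrite lse_leP//.
move: (sum_expR_lse (f ^~ x) J0 mu0) (sum_expR_lse (f ^~ y) J0 mu0).
move: (lse mu (f ^~ x)) (lse mu (f ^~ y)) => X Y SX SY.
set a := fun j => (f j x - X) / mu; set b := fun j => (f j y - Y) / mu.
case/andP: (t01) => t0 t1.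
have S1 : (1 - t) * \sum_j expR (a j) + t * \sum_j expR (b j) = 1.
  by rewrite [X in _ * X + _]SX [X in _ + _ * X]SY !mulr1 subrK.
rewrite -[leRHS]S1 !mulr_sumr -big_split/=; apply: ler_sum => j _.
apply: (@le_trans _ _ (expR ((1 - t) * a j + t * b j))).
  rewrite ler_expR ler_pdivrMr//.
  rewrite (_ : (_ + _) * mu = (1 - t) * (f j x - X) + t * (f j y - Y)); last first.
    by rewrite /a /b; field; rewrite gt_eqF.
  have := jf j t x y t01 Tx Ty; lra.
have := convex_expR (Itv01 (ltW t0) (ltW t1)) (b j) (a j).
rewrite !convRE /= -[unstable.onem t]/(1 - t).
by rewrite [t * b j + _]addrC [t * expR _ + _]addrC.
Qed.

End LogSumExp.

(** * Smallest eigenvalue of a positive definite matrix *)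

Section LambdaMin.
Context {R : realType}.

Lemma continuous_sum {T : topologicalType} {I : Type} (r : seq I)
    (F : I -> T -> R) :
  (forall i, continuous (F i)) -> continuous (fun x => \sum_(i <- r) F i x).
Proof. by move=> cF; apply: continuous_big => //; exact: add_continuous. Qed.

Lemma quadf_continuous n (A : 'M[R]_n) :
  continuous (fun v : 'rV[R]_n => quadf A v^T : R).
Proof.
have E v : quadf A v^T = \sum_i v 0 i * \sum_j A i j * v 0 j.
  rewrite /quadf dotcE; apply: eq_bigr => i _; rewrite mxE; congr (_ * _).
  by rewrite mxE; apply: eq_bigr => j _; rewrite mxE.
under eq_fun do rewrite E.
have c0 i : continuous (fun v : 'rV[R]_n => v 0 i : R) by exact: coord_continuous.
apply: continuous_sum => i v; apply: continuousM; first exact: c0.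
apply: continuous_sum => j {}v; apply: continuousM; last exact: c0.
exact: cst_continuous.
Qed.

Lemma sphere_compact n : compact [set v : 'rV[R]_n | normF v^T ^+ 2 = 1].
Proof.
have cn : continuous (fun v : 'rV[R]_n => normF v^T ^+ 2 : R).
  by under eq_fun do rewrite -quadf1; exact: quadf_continuous.
apply: bounded_closed_compact.
  exists 1; split=> // M M1 v /= v1.
  rewrite /Num.norm/= mx_normrE; apply/bigmax_leP; split => [|[i j] _] /=.
    by apply: le_trans (ltW M1).
  rewrite ord1; apply: le_trans (ltW M1).
  rewrite -(@ler_pXn2r _ 2)// ?nnegrE// expr1n -v1 normF_dotc dotcE.
  rewrite (bigD1 j)//= !mxE -expr2 real_normK ?num_real// lerDl.
  by apply: sumr_ge0 => k _; rewrite -expr2 sqr_ge0.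
apply: (closed_comp _ (_ : closed [set 1 : R])) => [v _|]; first exact: cn.
exact: closed_eq.
Qed.

(** The quadratic form attains its minimum on the unit sphere; homogeneity
    extends the inequality to all vectors. *)
Lemma rayleigh_min n (A : 'M[R]_n) : (0 < n)%N ->
  exists2 v : 'cV[R]_n, normF v = 1 &
    forall x, quadf A v * normF x ^+ 2 <= quadf A x.
Proof.
case: n A => // n A _; set K := [set v : 'rV[R]_n.+1 | normF v^T ^+ 2 = 1].
have K0 : K !=set0.
  exists (delta_mx 0 0); rewrite /K/= normF_dotc dotcE (bigD1 0)//= !mxE !eqxx mulr1.
  by rewrite big1 ?addr0// => i /negPf i0; rewrite !mxE i0 andbF mul0r.
have [v] := EVT_min_rV K0 (@sphere_compact n.+1)
  (continuous_subspaceT (@quadf_continuous n.+1 A)).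
rewrite inE /K/= => v1 vmin; exists v^T.
  by apply/eqP; rewrite -(@eqrXn2 _ 2)// ?normF_ge0// v1 expr1n.
move=> x; have [/normF_eq0 ->|x0] := eqVneq (normF x) 0.
  by rewrite normF_dotc /quadf mulmx0 -(scale0r (0 : 'cV_n.+1)) !dotc_lin !(mul0r, mulr0).
have := vmin (((normF x)^-1 *: x)^T).
rewrite inE /K/= trmxK normF_dotc !dotc_lin -normF_dotc.
rewrite [X in X = 1](_ : _ = 1) => [/(_ erefl)|]; last by field.
rewrite {2}/quadf -scalemxAr !dotc_lin -/(quadf A x) => H.
apply: le_trans (ler_wpM2r (sqr_ge0 _) H) _.
by rewrite le_eqVlt; apply/orP; left; apply/eqP; field.
Qed.

Lemma symmetricmx_tr n (A : 'M[R]_n) : A \is symmetricmx -> A^T = A.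
Proof. by move/is_hermitianmxP => {2}->; rewrite expr0 scale1r map_mx_id. Qed.

(** The form x |-> <x, A x> - a |x|^2 is nonnegative and vanishes at v, so its
    first-order variation at v vanishes. Testing it in the direction of the
    residual w = A v - a v gives |w|^2 = 0. *)
Lemma rayleigh_eigen n (A : 'M[R]_n) (v : 'cV[R]_n) : A \is symmetricmx ->
  normF v = 1 -> (forall x, quadf A v * normF x ^+ 2 <= quadf A x) ->
  A *m v = quadf A v *: v.
Proof.
move=> sA v1 vmin; set a := quadf A v; pose w := A *m v - a *: v.
have tA := symmetricmx_tr sA.
have sym x y : dotc x (A *m y) = dotc (A *m x) y.
  by rewrite /dotc trmx_mul tA mulmxA.
apply/eqP; rewrite -subr_eq0 -/w; have wE : w = A *m v - a *: v by [].
clearbody w; apply/eqP/normF_eq0.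
apply/eqP; rewrite -sqrf_eq0 eq_le sqr_ge0 andbT normF_dotc.
set N := dotc w w; pose b := quadf A w - a * N.
have b0 : 0 <= b by rewrite subr_ge0 /N -normF_dotc vmin.
(* second-order expansion of the quadratic form at v in the direction -w *)
have key t : 0 < t -> 2 * N <= t * b.
  move=> t0; have := vmin (v - t *: w).
  have -> : quadf A (v - t *: w) =
      a - 2 * t * dotc (A *m v) w + t ^+ 2 * quadf A w.
    rewrite /a /quadf mulmxDr mulmxN -scalemxAr !dotc_lin (sym v w).
    by rewrite (dotcC w (A *m v)); ring.
  rewrite normF_dotc !dotc_lin -normF_dotc v1 expr1n -/a -/N (dotcC w v).
  have E : N = dotc (A *m v) w - a * dotc v w.
    by rewrite /N {1}wE !dotc_lin.
  move=> H; rewrite -(ler_pM2l t0) /b; have := congr1 (fun r => t * r) E; move: H; lra.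
have b1 : 0 < b + 1 by rewrite ltr_wpDl.
rewrite leNgt; apply/negP => N0.
have := key _ (divr_gt0 N0 b1); rewrite mulrAC -mulrA.
have : b / (b + 1) <= 1 by rewrite ler_pdivrMr// mul1r lerDl.
move=> /(ler_wpM2l (ltW N0)); lra.
Qed.

(** A minimizer of the Rayleigh quotient is an eigenvector, and every
    eigenvalue is a value of the quotient. *)
Lemma lambda_min_pd n (A : 'M[R]_n) : (0 < n)%N -> pdmx A ->
  0 < lambda_min A /\ forall x, lambda_min A * normF x ^+ 2 <= quadf A x.
Proof.
move=> n0 [sA pA]; have [v v1 vmin] := rayleigh_min A n0.
have Av := rayleigh_eigen sA v1 vmin.
have tA := symmetricmx_tr sA.
have v0 : v != 0.
  apply/eqP => v0; have := normF_dotc v.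
  rewrite v1 v0 -(scale0r (0 : 'cV[R]_n)) dotcZl mul0r expr1n => /eqP.
  by rewrite oner_eq0.
suff -> : lambda_min A = quadf A v by split=> //; exact: pA.
have ev : [set a | eigenvalue A a] (quadf A v).
  apply/eigenvalueP; exists v^T; last by rewrite trmx_eq0.
  by rewrite -[in LHS]tA -trmx_mul Av linearZ.
have lb : lbound [set a | eigenvalue A a] (quadf A v).
  move=> a /eigenvalueP[u uA u0].
  have Au : A *m u^T = a *: u^T by rewrite -[in LHS]tA -trmx_mul uA linearZ.
  have := vmin u^T; rewrite {2}/quadf Au dotcZr -normF_dotc ler_pM2r//.
  rewrite lt_def sqr_ge0 andbT sqrf_eq0; apply: contra u0 => /eqP/normF_eq0.
  by move/eqP; rewrite trmx_eq0.
apply/eqP; rewrite eq_le; apply/andP; split.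
  by apply: ge_inf => //; exists (quadf A v).
by apply: lb_le_inf => //; exists (quadf A v).
Qed.

End LambdaMin.

(** * Piecewise quadratic loss *)

Section PiecewiseQuadraticRisk.
Context {R : realType} {d N J : nat}.
Variable D : pwq_data R d N J.
Implicit Types (Theta : set 'cV[R]_d).

(** A positive semidefinite form of an affine map, plus affine terms. *)
Lemma pwq_piece_jensen Theta j Z :
  psdmx (ulsubmx Z) -> strongly_jensen Theta 0 (pwq_piece D j Z).
Proof.
move=> [_ psdY]; rewrite -(addr0 0); apply: jensenD; last first.
  apply: jensen_of_affine => t x y.
  by rewrite /pwq_c !dotc_lin; ring.
rewrite -(addr0 0); apply: jensenD; last first.
  apply: jensen_of_affine => t x y.
  by rewrite /pwq_b affine_comb !dotc_lin; ring.
by apply: jensen_affine_quadf => x; rewrite mul0r mulr_ge0.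
Qed.

(** The dimension has to be positive: without eigenvalues the infimum in
    [lambda_min] is 0. *)
Lemma pwq_alphaP : (0 < d)%N -> (0 < J)%N ->
  (forall j, pdmx ((Abar D j)^T *m Abar D j)) ->
  0 < pwq_alpha D /\ forall j x,
  pwq_alpha D * normF x ^+ 2 <= 2 * quadf 1%:M (Abar D j *m x).
Proof.
move=> d0 J0 pd; split.
  rewrite /pwq_alpha mulr_gt0//; have [j ->] := fmin_attained
    (fun j => lambda_min ((Abar D j)^T *m Abar D j)) J0.
  by have [] := lambda_min_pd d0 (pd j).
move=> j x; rewrite /pwq_alpha -mulrA ler_pM2l//.
have [_ /(_ x)] := lambda_min_pd d0 (pd j).
have -> : quadf ((Abar D j)^T *m Abar D j) x = quadf 1%:M (Abar D j *m x).
  by rewrite /quadf /dotc mul1mx trmx_mul !mulmxA.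
apply: le_trans; rewrite ler_wpM2r ?sqr_ge0//.
exact: (fmin_le (fun j => lambda_min ((Abar D j)^T *m Abar D j))).
Qed.

Lemma pwq_reg_jensen Theta alpha rho j : 0 <= rho ->
  (forall x, alpha * normF x ^+ 2 <= 2 * quadf 1%:M (Abar D j *m x)) ->
  strongly_jensen Theta (rho * alpha) (pwq_reg D rho j).
Proof.
move=> rho0 al; apply: jensenZ => //; rewrite -(addr0 alpha); apply: jensenD.
  under [X in strongly_jensen _ _ X]eq_fun do rewrite -normF_dotc -quadf1.
  exact: jensen_affine_quadf.
by apply: jensen_of_affine => t x y; rewrite /pwq_c !dotc_lin; ring.
Qed.

Lemma pwq_risk_smoothE S mu rho (P : scen_dist R S (N + 1) (N + 1)) theta :
  pwq_risk_smooth D mu rho P theta =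
  scen_mean P (fun Z => lse mu (fun j => pwq_piece D j Z theta))
  + lse mu (fun j => pwq_reg D rho j theta).
Proof.
rewrite /pwq_risk_smooth /scen_mean mulr_sumr; congr (_ + _).
by apply: eq_bigr => s _; rewrite mulrCA.
Qed.

Lemma pwq_risk_smooth_le S mu rho (P : scen_dist R S (N + 1) (N + 1)) theta :
  (0 < J)%N -> 0 < mu ->
  pwq_risk_smooth D mu rho P theta
  <= pwq_risk D rho P theta + 2 * (mu * ln J%:R).
Proof.
move=> J0 mu0; rewrite pwq_risk_smoothE /pwq_risk.
have H1 := lse_le_fmax (fun j => pwq_reg D rho j theta) J0 mu0.
have H2 : scen_mean P (fun Z => lse mu (fun j => pwq_piece D j Z theta)) <=
    scen_mean P (fun Z => pwq_loss D Z theta) + mu * ln J%:R.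
  have -> : mu * ln J%:R = \sum_s weight P s * (mu * ln J%:R).
    by rewrite -mulr_suml weight_sum1 mul1r.
  rewrite -big_split/=.
  apply: ler_sum => s _; rewrite -mulrDr; apply: ler_wpM2l; first exact: weight_ge0.
  exact: lse_le_fmax.
lra.
Qed.

Lemma pwq_risk_gap Theta (rho : R)
    (Theta_convex : convex_set (Theta : set (convex_lmodType 'cV[R]_d)))
    (rho_gt0 : 0 < rho) (S : nat)
    (Phat : 'cV[R]_d -> scen_dist R S (N + 1) (N + 1))
    (Xi : set 'M[R]_(N + 1))
    (mu mu' eps Lz : R) (theta_RPO theta_RPS : 'cV[R]_d) :
  (0 < J)%N ->
  scenarios Theta Phat `<=` Xi ->
  (forall Z, scenarios Theta Phat Z -> psdmx (ulsubmx Z)) ->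
  (forall j, pdmx ((Abar D j)^T *m Abar D j)) ->
  sensitive Theta eps Phat ->
  0 <= Lz -> lipschitz_param Xi Theta Lz (pwq_loss D) ->
  0 < mu ->
  argmin Theta (fun theta => pwq_risk D rho (Phat theta) theta) theta_RPO ->
  argmin Theta (pwq_risk_smooth D mu rho (Phat theta_RPS)) theta_RPS ->
  mu <= mu' * normF (theta_RPS - theta_RPO) ->
  pwq_risk_smooth D mu rho (Phat theta_RPS) theta_RPS
    - pwq_risk D rho (Phat theta_RPO) theta_RPO
  <= 2 * (eps * Lz + 2 * mu' * ln J%:R) ^+ 2 / (rho * pwq_alpha D).
Proof.
move=> J0 sXi psd pd sens Lz0 lip mu0 [To _] amin mumu'; have [Ts _] := amin.
(* In dimension 0 the two decisions coincide, which contradicts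
   0 < mu <= mu' |theta_RPS - theta_RPO|. *)
have d0 : (0 < d)%N.
  rewrite lt0n; apply/eqP => d0; move: mumu'.
  have -> : normF (theta_RPS - theta_RPO) = 0.
    rewrite /normF big1 ?sqrtr0// => i _; exfalso.
    by case: i => i; rewrite {1}d0.
  by rewrite mulr0 leNgt mu0.
have [al0 al] := pwq_alphaP d0 J0 pd.
have jr : strongly_jensen Theta (rho * pwq_alpha D)
    (pwq_risk_smooth D mu rho (Phat theta_RPS)).
  rewrite (funext (pwq_risk_smoothE mu rho _)) -(add0r (rho * _)); apply: jensenD.
    apply: jensen_scen_mean => s; apply: lse_jensen => // j.
    by apply: pwq_piece_jensen; apply: psd; exists theta_RPS, s.
  by apply: lse_jensen => // j; apply: pwq_reg_jensen (al j); exact: ltW.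
have c0 := mulr_gt0 rho_gt0 al0; apply: le_trans (sqr_div_le _ c0).
apply: performative_gap c0 (argmin_growth Theta_convex jr amin To) _.
have shift := scen_mean_shift sens sXi Lz0 (lipschitz_param_sub lip To) Ts To.
have smooth := pwq_risk_smooth_le rho (Phat theta_RPS) theta_RPO J0 mu0.
have lnJ : 0 <= ln J%:R :> R by rewrite ln_ge0// ler1n.
have := ler_wpM2r lnJ mumu'; rewrite /pwq_risk in smooth *; lra.
Qed.

End PiecewiseQuadraticRisk.

(** * Concave loss with quadratic transport cost *)

Section ConcaveRisk.
Context {R : realType} {d m : nat}.
Variables (Zset : set 'cV[R]_m) (Theta : set 'cV[R]_d).
Variables (ell : 'cV[R]_m -> 'cV[R]_d -> R) (lo hi : R).
Hypothesis Zset_neq0 : Zset !=set0.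
Hypothesis ell_bounded :
  forall z theta, Zset z -> Theta theta -> lo <= ell z theta <= hi.
Implicit Types (theta : 'cV[R]_d) (lambda : R) (zhat : 'cV[R]_m).

(** Sup-convolution of the loss with a quadratic; for a concave loss this is,
    up to sign, its Moreau envelope. *)
Definition envelope theta lambda zhat : R :=
  sup [set ell z theta - lambda * normF (z - zhat) ^+ 2 | z in Zset].

Lemma envelope_ge theta lambda zhat z :
  Theta theta -> 0 <= lambda -> Zset z ->
  ell z theta - lambda * normF (z - zhat) ^+ 2 <= envelope theta lambda zhat.
Proof.
move=> Tt l0 Zz; apply: ub_le_sup; last by exists z.
exists hi => _ [y Zy <-]; have /andP[_] := ell_bounded Zy Tt.
by apply: le_trans; rewrite gerBl mulr_ge0// sqr_ge0.
Qed.

Lemma envelope_le theta lambda zhat M :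
  (forall z, Zset z -> ell z theta - lambda * normF (z - zhat) ^+ 2 <= M) ->
  envelope theta lambda zhat <= M.
Proof.
move=> zM; apply: ge_sup => [|_ [z Zz <-]]; last exact: zM.
by have [z Zz] := Zset_neq0; exists (ell z theta - lambda * normF (z - zhat) ^+ 2), z.
Qed.

(** The lower bound comes from the candidate z = zhat. *)
Lemma envelope_bounds theta lambda zhat :
  Theta theta -> 0 <= lambda -> Zset zhat ->
  lo <= envelope theta lambda zhat <= hi.
Proof.
move=> Tt l0 Zz; apply/andP; split.
  apply: le_trans (envelope_ge _ Tt l0 Zz).
  have /andP[+ _] := ell_bounded Zz Tt; move=> /le_trans; apply.
  by rewrite subrr normF0 expr0n mulr0 subr0.
apply: envelope_le => z Zz'; have /andP[_] := ell_bounded Zz' Tt.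
by apply: le_trans; rewrite gerBl mulr_ge0// sqr_ge0.
Qed.

(** With K = Lz, r = |z - z1| and del = |z1 - z2|, the left-hand sides bound the
    loss incurred when a point z tested at z1 is replaced, at z2, by z2 itself
    or by z again. If the first bound fails then x = del / r < 1 and
    lambda r <= K (1 - x), so the second one follows from
    (1 - x) (2 + x) <= 2. *)
Lemma envelope_two_candidates (lambda K r del : R) :
  0 <= lambda -> 0 <= K -> 0 <= r -> 0 <= del ->
  K * (r + del) - lambda * r ^+ 2 <= 2 * K * del \/
  lambda * (2 * r * del + del ^+ 2) <= 2 * K * del.
Proof.
move=> l0 K0 r0 del0.
have [H|H] := lerP (K * (r - del)) (lambda * r ^+ 2); [left; lra|right].
have lr : 0 <= lambda * r ^+ 2 by rewrite mulr_ge0// sqr_ge0.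
have rd : del < r.
  by rewrite ltNge; apply/negP => rd; have := ler_wpM2l K0 rd; lra.
have r2 : 0 < r ^+ 2 by rewrite exprn_gt0// (le_lt_trans del0).
suff : lambda * (2 * r + del) <= 2 * K.
  by move=> /(ler_wpM2r del0); lra.
rewrite -(ler_pM2r r2).
have s0 : 0 <= 2 * r + del by rewrite addr_ge0// mulr_ge0.
have := ler_wpM2r s0 (ltW H).
have := mulr_ge0 K0 (mulr_ge0 r0 del0); have := mulr_ge0 K0 (sqr_ge0 del).
lra.
Qed.

(** The slope does not depend on lambda: a point so far away that the quadratic
    penalty is steep there is beaten by the scenario itself. *)
Lemma envelope_lipschitz theta lambda Lz z1 z2 :
  lipschitz_param Zset Theta Lz ell -> 0 <= Lz ->
  Theta theta -> 0 <= lambda -> Zset z1 -> Zset z2 ->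
  envelope theta lambda z1 - envelope theta lambda z2 <= 2 * Lz * normF (z1 - z2).
Proof.
move=> lip Lz0 Tt l0 Z1 Z2; rewrite lerBlDl; apply: envelope_le => z Zz.
have triangle : normF (z - z2) <= normF (z - z1) + normF (z1 - z2).
  by apply: le_trans (normF_triangle _ _); rewrite addrA subrK.
have [H|H] := envelope_two_candidates l0 Lz0 (normF_ge0 (z - z1)) (normF_ge0 (z1 - z2)).
- have := envelope_ge z2 Tt l0 Z2.
  rewrite subrr normF0 expr0n mulr0 subr0.
  have := lipschitz_param_sub lip Tt Zz Z2; have := ler_wpM2l Lz0 triangle; lra.
- have := envelope_ge z2 Tt l0 Zz.
  have : normF (z - z2) ^+ 2 <= (normF (z - z1) + normF (z1 - z2)) ^+ 2.
    by rewrite ler_sqr ?nnegrE ?addr_ge0 ?normF_ge0.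
  move=> /(ler_wpM2l l0); lra.
Qed.

(** Each member of the supremum is strongly convex in theta and affine in
    lambda, and a supremum of functions that satisfy the same inequality
    satisfies it too. *)
Lemma envelope_jensen gamma t theta theta' lambda lambda' zhat :
  convex_set (Theta : set (convex_lmodType 'cV[R]_d)) ->
  strongly_convex Zset Theta gamma ell -> 0 < t < 1 ->
  Theta theta -> Theta theta' -> 0 <= lambda -> 0 <= lambda' ->
  envelope ((1 - t) *: theta + t *: theta') ((1 - t) * lambda + t * lambda') zhat
  <= (1 - t) * envelope theta lambda zhat + t * envelope theta' lambda' zhat
     - t * (1 - t) * (gamma / 2 * normF (theta - theta') ^+ 2).
Proof.
move=> cT sc t01 Tt Tt' l0 l0'; apply: envelope_le => z Zz.
have := strongly_convex_jensen cT sc Zz t01 Tt Tt'.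
have /andP[t0 t1] := t01; have t1' : 0 <= 1 - t by rewrite subr_ge0 ltW.
have := ler_wpM2l t1' (envelope_ge zhat Tt l0 Zz).
have := ler_wpM2l (ltW t0) (envelope_ge zhat Tt' l0' Zz).
lra.
Qed.

(** The growth used is the one in theta alone; in lambda plain convexity of
    tau lambda^2 is enough. *)
Lemma conc_risk_reg_growth S tau rho gamma (P : scen_dist R S m 1) x y :
  convex_set (Theta : set (convex_lmodType 'cV[R]_d)) ->
  strongly_convex Zset Theta gamma ell -> 0 <= tau ->
  argmin (Theta `*` [set lambda | 0 <= lambda])
    (conc_risk_reg Zset ell tau rho P) x ->
  Theta y.1 -> 0 <= y.2 ->
  conc_risk_reg Zset ell tau rho P x + gamma / 2 * normF (x.1 - y.1) ^+ 2
  <= conc_risk_reg Zset ell tau rho P y.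
Proof.
move=> cT sc tau0 [[Tx lx] xmin] Ty ly; apply: jensen_limit => t t01.
have /andP[t0 t1] := t01; have t1' : 0 <= 1 - t by rewrite subr_ge0 ltW.
pose w := ((1 - t) *: x.1 + t *: y.1, (1 - t) * x.2 + t * y.2).
apply: (@le_trans _ _ (conc_risk_reg Zset ell tau rho P w)).
  apply: xmin; split => /=; first exact: convex_set_comb.
  by rewrite addr_ge0// mulr_ge0// ltW.
rewrite /conc_risk_reg /conc_risk.
set K := gamma / 2 * _.
have -> : (1 - t) * (scen_mean P (envelope x.1 x.2) + rho ^+ 2 * x.2 + tau * x.2 ^+ 2)
   + t * (scen_mean P (envelope y.1 y.2) + rho ^+ 2 * y.2 + tau * y.2 ^+ 2)
   - t * (1 - t) * K =
   ((1 - t) * scen_mean P (envelope x.1 x.2) + t * scen_mean P (envelope y.1 y.2)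
    - t * (1 - t) * K) + rho ^+ 2 * w.2 + tau * ((1 - t) * x.2 ^+ 2 + t * y.2 ^+ 2).
  by rewrite /w/=; ring.
apply: lerD; first (apply: lerD => //).
  have -> : t * (1 - t) * K = \sum_s weight P s * (t * (1 - t) * K).
    by rewrite -mulr_suml weight_sum1 mul1r.
  rewrite /scen_mean !mulr_sumr -sumrN -!big_split/=; apply: ler_sum => s _.
  apply: le_trans (ler_wpM2l (weight_ge0 P s)
    (envelope_jensen (scen P s) cT sc t01 Tx Ty lx ly)) _.
  by rewrite -/K le_eqVlt; apply/orP; left; apply/eqP; ring.
apply: ler_wpM2l => //; rewrite /w/=.
have := mulr_ge0 (mulr_ge0 (ltW t0) t1') (sqr_ge0 (x.2 - y.2)); lra.
Qed.

End ConcaveRisk.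

(** At [lambda_bar] the cost tau lambda^2 + rho^2 lambda of the multiplier uses up
    the whole range of the loss; beyond it, the multiplier 0 is competitive. *)
Lemma lambda_barP {R : realType} (tau rho lo hi : R) : 0 < tau -> lo <= hi ->
  0 <= lambda_bar tau rho lo hi /\
  tau * lambda_bar tau rho lo hi ^+ 2 + rho ^+ 2 * lambda_bar tau rho lo hi
  = hi - lo.
Proof.
move=> tau0 lohi; rewrite /lambda_bar; set D := rho ^+ 4 + _.
have D0 : rho ^+ 4 <= D by rewrite lerDl mulr_ge0 ?subr_ge0// mulr_ge0// ltW.
have rho4 : rho ^+ 4 = (rho ^+ 2) ^+ 2 by rewrite -exprM.
have sD : Num.sqrt D ^+ 2 = D.
  by rewrite sqr_sqrtr// (le_trans _ D0)// rho4 sqr_ge0.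
split.
  apply: divr_ge0; last by rewrite mulr_ge0// ltW.
  have e : rho ^+ 2 = Num.sqrt (rho ^+ 4).
    by rewrite rho4 sqrtr_sqr ger0_norm// sqr_ge0.
  by rewrite subr_ge0 e ler_wsqrtr.
apply: (@mulfI _ (4 * tau)); first by rewrite gt_eqF// mulr_gt0.
rewrite (_ : 4 * tau * (_ + _) = Num.sqrt D ^+ 2 - rho ^+ 4).
  by rewrite sD /D; ring.
by field; rewrite gt_eqF.
Qed.

Lemma conc_risk_gap {R : realType} {d : nat} (Theta : set 'cV[R]_d) (rho : R)
    (Theta_convex : convex_set (Theta : set (convex_lmodType 'cV[R]_d)))
    (m S : nat) (Zset : set 'cV[R]_m)
    (Phat : 'cV[R]_d -> scen_dist R S m 1)
    (ell : 'cV[R]_m -> 'cV[R]_d -> R)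
    (gamma eps Lz Ltheta tau lo hi : R) (tb_RPO tb_RPS : 'cV[R]_d * R) :
  Zset !=set0 -> scenarios Theta Phat `<=` Zset ->
  0 < gamma -> strongly_convex Zset Theta gamma ell ->
  0 <= eps -> sensitive Theta eps Phat ->
  0 <= Lz -> lipschitz_param Zset Theta Lz ell ->
  0 <= Ltheta -> 0 < tau ->
  (forall z theta, Zset z -> Theta theta -> lo <= ell z theta <= hi) ->
  argmin (Theta `*` [set lambda | 0 <= lambda])
    (fun tb => conc_risk Zset ell rho (Phat tb.1) tb) tb_RPO ->
  argmin (Theta `*` [set lambda | 0 <= lambda])
    (conc_risk_reg Zset ell tau rho (Phat tb_RPS.1)) tb_RPS ->
  conc_risk_reg Zset ell tau rho (Phat tb_RPS.1) tb_RPS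
    - conc_risk Zset ell rho (Phat tb_RPO.1) tb_RPO
  <= tau * lambda_bar tau rho lo hi ^+ 2
     + (2 * tau * lambda_bar tau rho lo hi + rho ^+ 2
        + diameter Zset ^+ 2 + Ltheta + eps * Lz)
       * (2 * eps * Lz) / Num.min gamma (2 * tau).
Proof.
case: tb_RPO tb_RPS => [theta_o lambda_o] [theta_s lambda_s].
move=> Z0 sZ g0 sc eps0 sens Lz0 lip Lt0 tau0 bnd [[/= To lo0] _] amin.
have [[/= Ts ls0] smin] := amin.
have lohi : lo <= hi.
  have [z Zz] := Z0; have /andP[] := bnd z theta_o Zz To; exact: le_trans.
have [B0 BE] := lambda_barP rho tau0 lohi.
set B := lambda_bar _ _ _ _ in B0 BE *.
set W := 2 * tau * B + _ + _ + _.
have W0 : 0 <= W.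
  have := mulr_ge0 (ltW tau0) B0; have := sqr_ge0 rho.
  by have := sqr_ge0 (diameter Zset); rewrite /W; lra.
set kappa := Num.min _ _.
have k0 : 0 < kappa by rewrite lt_min g0 mulr_gt0.
have eL : 0 <= eps * Lz by rewrite mulr_ge0.
(* kappa <= gamma, and 2 (eps Lz)^2 is one of the terms of the expanded
   right-hand side. *)
have slack : (2 * eps * Lz) ^+ 2 / (2 * gamma) <= (W + eps * Lz) * (2 * eps * Lz) / kappa.
  rewrite (_ : (2 * eps * Lz) ^+ 2 / (2 * gamma) = 2 * (eps * Lz) ^+ 2 / gamma).
    apply: ler_pM; rewrite ?invr_ge0 ?(ltW g0) ?mulr_ge0 ?sqr_ge0//.
      by have := mulr_ge0 W0 eL; lra.
    by rewrite lef_pV2 ?posrE// ge_min lexx.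
  by field; rewrite gt_eqF.
have E0 : 0 <= (W + eps * Lz) * (2 * eps * Lz) / kappa.
  by apply: le_trans slack; rewrite divr_ge0 ?sqr_ge0// mulr_ge0// ltW.
have Phat_Z theta s : Theta theta -> Zset (scen (Phat theta) s).
  by move=> Tt; apply: sZ; exists theta, s.
have [loB|Blo] := lerP lambda_o B.
  apply: le_trans (_ : tau * lambda_o ^+ 2 + _ <= _); last first.
    apply: lerD slack; rewrite ler_wpM2l ?(ltW tau0)//.
    by rewrite ler_sqr ?nnegrE.
  rewrite -lerBlDl -addrA -opprD.
  have := conc_risk_reg_growth Z0 bnd Theta_convex sc (ltW tau0) amin
    (y := (theta_o, lambda_o)) To lo0.
  move=> /(performative_gap g0); apply.
  rewrite /conc_risk_reg /conc_risk /=.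
  have shift := scen_mean_shift (f := envelope Zset ell theta_o lambda_o)
    sens sZ (mulr_ge0 (ler0n R 2) Lz0) _ Ts To.
  have := shift (fun z z' => envelope_lipschitz Z0 bnd lip Lz0 To lo0).
  rewrite /envelope; lra.
(* lambda_o exceeds lambda_bar: compare with (theta_o, 0) instead. *)
have shi : conc_risk_reg Zset ell tau rho (Phat theta_s) (theta_s, lambda_s) <= hi.
  apply: le_trans (smin (theta_o, 0) _) _; first by split => /=.
  rewrite /conc_risk_reg /conc_risk /= expr0n !mulr0 !addr0.
  rewrite -[hi]mul1r -(weight_sum1 (Phat theta_s)) mulr_suml.
  apply: ler_sum => s _; rewrite ler_wpM2l ?weight_ge0//.
  by have /andP[] := envelope_bounds Z0 bnd To (lexx 0) (Phat_Z _ s Ts).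
have olo : lo + rho ^+ 2 * lambda_o <=
    conc_risk Zset ell rho (Phat theta_o) (theta_o, lambda_o).
  rewrite /conc_risk lerD2r -[lo]mul1r -(weight_sum1 (Phat theta_o)) mulr_suml.
  apply: ler_sum => s _; rewrite ler_wpM2l ?weight_ge0//.
  by have /andP[] := envelope_bounds Z0 bnd To lo0 (Phat_Z _ s To).
have := ler_wpM2l (sqr_ge0 rho) (ltW Blo); lra.
Qed.

Theorem theorem2 (R : realType) (d : nat) (Theta : set 'cV[R]_d) (rho : R)
    (Theta_neq0 : Theta !=set0) (Theta_closed : closed Theta)
    (Theta_convex : convex_set (Theta : set (convex_lmodType 'cV[R]_d)))
    (rho_gt0 : 0 < rho) :
  (* (a), Model 1 *)
  (forall (S : nat) (Phat : 'cV[R]_d -> scen_dist R S (d + 1) (d + 1))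
      (Xi : set 'M[R]_(d + 1)) (cL : R -> R)
      (L gamma beta eps Lz : R) (theta_RPO theta_RPS : 'cV[R]_d),
    Xi `<=` sym_params R (d + 1) ->
    scenarios Theta Phat `<=` Xi ->
    (forall x y, `|cL x - cL y| <= L * `|x - y|) ->
    loss_convex Xi Theta (quad_loss cL) ->
    loss_differentiable Xi Theta (quad_loss cL) ->
    0 < gamma -> strongly_convex Xi Theta gamma (quad_loss cL) ->
    smooth_loss Xi Theta beta (quad_loss cL) ->
    0 <= eps -> sensitive Theta eps Phat ->
    0 <= Lz -> lipschitz_param Xi Theta Lz (quad_loss cL) ->
    argmin Theta (fun theta => quad_risk cL L rho (Phat theta) theta)
      theta_RPO ->
    argmin Theta (quad_risk cL L rho (Phat theta_RPS)) theta_RPS ->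
    quad_risk cL L rho (Phat theta_RPS) theta_RPS
      - quad_risk cL L rho (Phat theta_RPO) theta_RPO
    <= 2 * eps ^+ 2 * Lz ^+ 2 / (gamma + 2 * rho * L))
  /\
  (* (b), Model 2 *)
  (forall (N J S : nat) (D : pwq_data R d N J)
      (Phat : 'cV[R]_d -> scen_dist R S (N + 1) (N + 1))
      (Xi : set 'M[R]_(N + 1))
      (mu mu' eps Lz : R) (theta_RPO theta_RPS : 'cV[R]_d),
    (0 < J)%N ->
    Xi `<=` sym_params R (N + 1) ->
    scenarios Theta Phat `<=` Xi ->
    (forall Z, scenarios Theta Phat Z -> psdmx (ulsubmx Z)) ->
    loss_convex (scenarios Theta Phat) Theta (pwq_loss D) ->
    (forall j, pdmx ((Abar D j)^T *m Abar D j)) ->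
    bounded_set Theta ->
    bounded_set (\bigcup_(theta in Theta) scen_support (Phat theta)) ->
    0 <= eps -> sensitive Theta eps Phat ->
    0 <= Lz -> lipschitz_param Xi Theta Lz (pwq_loss D) ->
    0 < mu ->
    argmin Theta (fun theta => pwq_risk D rho (Phat theta) theta) theta_RPO ->
    argmin Theta (pwq_risk_smooth D mu rho (Phat theta_RPS)) theta_RPS ->
    0 <= mu' <= 1 ->
    mu <= mu' * normF (theta_RPS - theta_RPO) ->
    pwq_risk_smooth D mu rho (Phat theta_RPS) theta_RPS
      - pwq_risk D rho (Phat theta_RPO) theta_RPO
    <= 2 * (eps * Lz + 2 * mu' * ln J%:R) ^+ 2 / (rho * pwq_alpha D))
  /\
  (* (c), Model 3 *)
  (forall (m S : nat) (Zset : set 'cV[R]_m)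
      (Phat : 'cV[R]_d -> scen_dist R S m 1)
      (ell : 'cV[R]_m -> 'cV[R]_d -> R)
      (gamma beta eps Lz Ltheta tau lo hi : R)
      (tb_RPO tb_RPS : 'cV[R]_d * R),
    Zset !=set0 ->
    convex_set (Zset : set (convex_lmodType 'cV[R]_m)) ->
    closed Zset ->
    scenarios Theta Phat `<=` Zset ->
    (forall theta, Theta theta ->
      convex_function (Zset : set (convex_lmodType 'cV[R]_m))
        (fun z => - ell z theta)) ->
    (forall theta, Theta theta ->
      upper_semicontinuous_on Zset (ell ^~ theta)) ->
    bounded_set Theta ->
    finite_diameter Zset ->
    loss_convex Zset Theta ell ->
    loss_differentiable Zset Theta ell ->
    0 < gamma -> strongly_convex Zset Theta gamma ell ->
    smooth_loss Zset Theta beta ell ->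
    0 <= eps -> sensitive Theta eps Phat ->
    0 <= Lz -> lipschitz_param Zset Theta Lz ell ->
    0 <= Ltheta -> lipschitz_decision Zset Theta Ltheta ell ->
    0 < tau ->
    (forall z theta, Zset z -> Theta theta -> lo <= ell z theta <= hi) ->
    argmin (Theta `*` [set lambda | 0 <= lambda])
      (fun tb => conc_risk Zset ell rho (Phat tb.1) tb) tb_RPO ->
    argmin (Theta `*` [set lambda | 0 <= lambda])
      (conc_risk_reg Zset ell tau rho (Phat tb_RPS.1)) tb_RPS ->
    conc_risk_reg Zset ell tau rho (Phat tb_RPS.1) tb_RPS
      - conc_risk Zset ell rho (Phat tb_RPO.1) tb_RPO
    <= tau * lambda_bar tau rho lo hi ^+ 2
       + (2 * tau * lambda_bar tau rho lo hi + rho ^+ 2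
          + diameter Zset ^+ 2 + Ltheta + eps * Lz)
         * (2 * eps * Lz) / Num.min gamma (2 * tau)).
Proof.
split; [|split].
- move=> S Phat Xi cL L gamma beta eps Lz t_o t_s _ sXi lipL _ _ g0 sc _ _.
  move=> sens Lz0 lip; exact: (quad_risk_gap Theta_convex rho_gt0 sXi).
- move=> N J S D Phat Xi mu mu' eps Lz t_o t_s J0 _ sXi psd _ pd _ _ _.
  move=> sens Lz0 lip mu0 mino mins _; exact: (pwq_risk_gap Theta_convex rho_gt0 J0 sXi).
- move=> m S Zset Phat ell gamma beta eps Lz Ltheta tau lo hi tb_o tb_s.
  move=> Z0 _ _ sZ _ _ _ _ _ _ g0 sc _ eps0 sens Lz0 lip Lt0 _ tau0 bnd.
  exact: (conc_risk_gap Theta_convex).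
Qed.
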